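(* Let the problem data, the weights $a_j^i(k)$ and the coefficients $c(k)$ satisfy Assumptions (Convexity), (Compactness), (Slater), (Coefficient), (Weights) and (Connectivity) stated in the context, and let the sequences $\{\lambda_i(k)\}_{k\ge 0}$, $i=1,\dots,m$, be generated by the algorithm described in the context. Then there exists $\lambda^\star\in\Lambda^\star$ such that $$\lim_{k\to\infty}\|\lambda_i(k)-\lambda^\star\|=0\quad\text{for all } i=1,\dots,m .$$
   Context: Notation. $\|\cdot\|$ is the Euclidean norm; $\mathbb{R}^p_+$ is the non-negative orthant of $\mathbb{R}^p$ ($\lambda\ge 0$ means $\lambda\in\mathbb{R}^p_+$); vector inequalities are component-wise; $\operatorname{relint}$ is relative interior. Problem. There are $m$ agents. Agent $i$ has a set $X_i\subseteq\mathbb{R}^{n_i}$ and functions $f_i:\mathbb{R}^{n_i}\to\mathbb{R}$, $g_i:\mathbb{R}^{n_i}\to\mathbb{R}^p$. Let $n=\sum_i n_i$, $X=X_1\times\cdots\times X_m\subseteq\mathbb{R}^n$, $x=(x_1,\dots,x_m)$. The primal problem $\mathcal{P}$ is: minimize $\sum_{i=1}^m f_i(x_i)$ over $x\in X$ subject to $\sum_{i=1}^m g_i(x_i)\le 0$. Let $L_i(x_i,\lambda)=f_i(x_i)+\lambda^\top g_i(x_i)$, $L(x,\lambda)=\sum_{i=1}^m L_i(x_i,\lambda)$, $\varphi_i(\lambda)=\min_{x_i\in X_i}L_i(x_i,\lambda)$. The dual problem $\mathcal{D}$ is: maximize $\sum_{i=1}^m\varphi_i(\lambda)$ over $\lambda\in\mathbb{R}^p_+$.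 $\Lambda^\star$ denotes the set of all maximizers of $\mathcal{D}$. Algorithm. Take any $\hat x_i(0)\in X_i$ and $\lambda_i(0)\in\mathbb{R}^p_+$, $i=1,\dots,m$. For $k=0,1,2,\dots$ and each $i$: - $\ell_i(k)=\sum_{j=1}^m a_j^i(k)\lambda_j(k)$; - $x_i(k+1)\in\arg\min_{x_i\in X_i}\{f_i(x_i)+\ell_i(k)^\top g_i(x_i)\}$ (any minimizer); - $\lambda_i(k+1)=\arg\max_{\lambda_i\ge 0}\{g_i(x_i(k+1))^\top\lambda_i-\frac{1}{2c(k)}\|\lambda_i-\ell_i(k)\|^2\}$; - $\hat x_i(k+1)=\hat x_i(k)+\frac{c(k)}{\sum_{r=0}^k c(r)}(x_i(k+1)-\hat x_i(k))$. Assumptions. (Convexity) For each $i$, $f_i$ and each component of $g_i$ are convex on $\mathbb{R}^{n_i}$, and $X_i$ is convex. (Compactness) Each $X_i$ is compact. (Slater) There exists $\tilde x=(\tilde x_1,\dots,\tilde x_m)\in\operatorname{relint}(X)$ such that $\sum_{i=1}^m g_i(\tilde x_i)\le 0$ for those components of $\sum_{i=1}^m g_i(x_i)$ that are linear (i.e. affine) in $x$, if any, while $\sum_{i=1}^m g_i(\tilde x_i)<0$ for all other components. (Coefficient) $\{c(k)\}_{k\ge 0}$ is a non-increasing sequence of positive reals with $\sum_{k=0}^\infty c(k)=\infty$ and $\sum_{k=0}^\infty c(k)^2<\infty$. (Weights) There exists $\eta\in(0,1)$ such that for all $i,j\in\{1,\dots,m\}$ and all $k\ge 0$: $a_j^i(k)\in[0,1)$,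 $a_i^i(k)\ge\eta$, and $a_j^i(k)>0$ implies $a_j^i(k)\ge\eta$. Moreover, for all $k\ge 0$, $\sum_{j=1}^m a_j^i(k)=1$ for all $i$ and $\sum_{i=1}^m a_j^i(k)=1$ for all $j$. (Connectivity) Let $V=\{1,\dots,m\}$, $E_k=\{(j,i): a_j^i(k)>0\}$ and $E_\infty=\{(j,i):(j,i)\in E_k\text{ for infinitely many }k\}$. The directed graph $(V,E_\infty)$ is strongly connected, and there exists $T\ge 1$ such that for every $(j,i)\in E_\infty$, agent $i$ receives information from agent $j$ at least once every $T$ consecutive iterations, i.e. for every $k\ge0$, $(j,i)\in E_k\cup E_{k+1}\cup\dots\cup E_{k+T-1}$. *)

(* Defs.v *)
From mathcomp Require Import all_boot all_order all_algebra.
From mathcomp Require Import all_classical all_reals all_analysis.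

Import Order.TTheory GRing.Theory Num.Theory.
Import numFieldNormedType.Exports.

Local Open Scope classical_set_scope.
Local Open Scope ring_scope.

Section euclidean.
Context {R : realType}.

Definition dotp {d} (u v : 'rV[R]_d) : R := \sum_(j < d) u ord0 j * v ord0 j.

(* The norm `|v| of the library on 'rV[R]_d is the sup norm, hence this one. *)
Definition enorm {d} (v : 'rV[R]_d) : R := Num.sqrt (dotp v v).

Definition orthant {d} : set 'rV[R]_d := [set v | forall j, 0 <= v ord0 j].

Definition affine_hull {d} (A : set 'rV[R]_d) : set 'rV[R]_d :=
  [set x | exists (N : nat) (y : 'I_N -> 'rV[R]_d) (t : 'I_N -> R),
    [/\ forall k, A (y k), \sum_(k < N) t k = 1 & x = \sum_(k < N) t k *: y k]].

Definition relint {d} (A : set 'rV[R]_d) : set 'rV[R]_d :=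
  [set x | A x /\ exists2 e : R, 0 < e &
    forall y, affine_hull A y -> enorm (y - x) < e -> A y].

Definition affine_function {d} (h : 'rV[R]_d -> R) : Prop :=
  exists (u : 'rV[R]_d) (b : R), forall x, h x = dotp u x + b.

End euclidean.

Section optimization.
Context {R : realType} {T : Type}.

Definition argmin (A : set T) (h : T -> R) : set T :=
  [set x | A x /\ forall y, A y -> h x <= h y].

Definition argmax (A : set T) (h : T -> R) : set T :=
  [set x | A x /\ forall y, A y -> h y <= h x].

(* The least element of h(A); an arbitrary real if there is none. *)
Definition minval (A : set T) (h : T -> R) : R :=
  get ((h @` A) `&` lbound (h @` A)).

End optimization.

Section problem.
Context {R : realType} {m p : nat} {n : 'I_m -> nat}.
Variables (X : forall i, set 'rV[R]_(n i)).
Variables (f : forall i, 'rV[R]_(n i) -> R).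
Variables (g : forall i, 'rV[R]_(n i) -> 'rV[R]_p).

Definition lagrangian (i : 'I_m) (lam : 'rV[R]_p) (x : 'rV[R]_(n i)) : R :=
  f i x + dotp lam (g i x).

Definition phi (i : 'I_m) (lam : 'rV[R]_p) : R :=
  minval (X i) (lagrangian i lam).

Definition dual_optima : set 'rV[R]_p :=
  argmax orthant (fun lam => \sum_(i < m) phi i lam).

(* A point of R^(n_1 + ... + n_m) has the blocks submxrow x i. *)
Definition product_set : set 'rV[R]_(\sum_(i < m) n i)%N :=
  [set x | forall i, X i (submxrow x i)].

Definition constraint (j : 'I_p) (x : 'rV[R]_(\sum_(i < m) n i)%N) : R :=
  \sum_(i < m) g i (submxrow x i) ord0 j.

Definition convexity : Prop :=
  forall i, [/\ convex_function setT (f i),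
    forall j, convex_function setT (fun x => g i x ord0 j)
    & convex_set (X i)].

Definition compactness : Prop := forall i, compact (X i).

Definition slater : Prop :=
  exists2 x, relint product_set x &
    forall j, (affine_function (constraint j) -> constraint j x <= 0) /\
              (~ affine_function (constraint j) -> constraint j x < 0).

End problem.

Section algorithm.
Context {R : realType} {m p : nat} {n : 'I_m -> nat}.
Variables (X : forall i, set 'rV[R]_(n i)).
Variables (f : forall i, 'rV[R]_(n i) -> R).
Variables (g : forall i, 'rV[R]_(n i) -> 'rV[R]_p).
Variable c : nat -> R.
(* [a k i j] is a^i_j(k): the weight that i gives to j at time k. *)
Variable a : nat -> 'I_m -> 'I_m -> R.

Definition coefficients : Prop :=
  [/\ forall k, 0 < c k,
      {homo c : k l / (k <= l)%N >-> l <= k},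
      series c @ \oo --> +oo
    & cvgn (series (fun k => c k ^+ 2))].

Definition weights : Prop :=
  (exists eta : R, 0 < eta < 1 /\ forall i j k,
    [/\ 0 <= a k i j < 1, eta <= a k i i & 0 < a k i j -> eta <= a k i j]) /\
  (forall k, (forall i, \sum_(j < m) a k i j = 1) /\
             (forall j, \sum_(i < m) a k i j = 1)).

Definition edge (k : nat) : rel 'I_m := fun j i => 0 < a k i j.

Definition edge_inf : rel 'I_m :=
  fun j i => `[< infinite_set [set k | edge k j i] >].

Definition connectivity : Prop :=
  (forall j i, connect edge_inf j i) /\
  exists2 T : nat, (1 <= T)%N & forall j i, edge_inf j i ->
    forall k, exists2 l : nat, (k <= l < k + T)%N & edge l j i.

Definition mixed (lam : nat -> 'I_m -> 'rV[R]_p) (k : nat) (i : 'I_m) :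
    'rV[R]_p :=
  \sum_(j < m) a k i j *: lam k j.

(* The value x 0 is not used by the algorithm and is left unconstrained. *)
Definition generated (x xhat : nat -> forall i, 'rV[R]_(n i))
    (lam : nat -> 'I_m -> 'rV[R]_p) : Prop :=
  (forall i, X i (xhat 0%N i) /\ orthant (lam 0%N i)) /\
  forall k i,
    [/\ argmin (X i) (fun y => f i y + dotp (mixed lam k i) (g i y)) (x k.+1 i),
        argmax orthant
          (fun l => dotp (g i (x k.+1 i)) l
                    - (2 * c k)^-1 * enorm (l - mixed lam k i) ^+ 2)
          (lam k.+1 i)
      & xhat k.+1 i = xhat k i
          + (c k / \sum_(0 <= r < k.+1) c r) *: (x k.+1 i - xhat k i)].

End algorithm.

(* Main.v *)
(* The algorithm is a distributed projected subgradient method for the dual. The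
   minimizer [x_i(k+1)] gives a supergradient of [phi_i] at [l_i(k)], so for
   every [l >= 0] the quantity [S_k(l) = \sum_i |lam_i(k) - l|^2] satisfies,
   with [v(k)] the average of the [lam_i(k)], [phi = \sum_i phi_i] and
   [Q_k = \sum_i |lam_i(k) - v(k)|],
     S_{k+1}(l) <= S_k(l) + 2 c(k) (phi(v(k)) - phi(l)) + O(c(k) Q_k + c(k)^2).
   Over a window of fixed length the product of the weight matrices is doubly
   stochastic with entries bounded below, hence contracts [Q]; since [c] is
   square summable, [\sum_k c(k) Q_k] is finite. For [l] optimal this bounds
   [\sum_k c(k) (phi(l) - phi(v(k)) + Q_k)], and as [\sum_k c(k)] diverges the
   summand is small along a subsequence; a cluster point [l0] of that
   subsequence is optimal, and [S_k(l0)], which decreases up to a summable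
   error and has inferior limit 0, tends to 0.

   An optimal [l] exists because the dual problem, regularized by a small
   quadratic term, cannot have maximizers escaping to infinity: by the Slater
   condition the dual function is constant along an escape direction. *)

Require Import Defs.
From mathcomp Require Import all_boot all_order all_algebra.
From mathcomp Require Import all_classical all_reals all_analysis.
From mathcomp Require Import ring lra zify.

Import Order.TTheory GRing.Theory Num.Theory.
Import numFieldNormedType.Exports.

Local Open Scope classical_set_scope.
Local Open Scope ring_scope.

(** * Inner product and convex functions *)

Section dotp.
Context {R : realType} {d : nat}.
Implicit Types (u v w : 'rV[R]_d) (t : R).

Lemma dotpC u v : dotp u v = dotp v u.
Proof. by apply: eq_bigr => j _; rewrite mulrC. Qed.

Lemma dotpDl u v w : dotp (u + v) w = dotp u w + dotp v w.
Proof.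
by rewrite /dotp -big_split; apply: eq_bigr => j _; rewrite !mxE mulrDl.
Qed.

Lemma dotpZl t u v : dotp (t *: u) v = t * dotp u v.
Proof.
by rewrite /dotp mulr_sumr; apply: eq_bigr => j _; rewrite !mxE mulrA.
Qed.

Lemma dotpDr u v w : dotp w (u + v) = dotp w u + dotp w v.
Proof. by rewrite dotpC dotpDl !(dotpC w). Qed.

Lemma dotpZr t u v : dotp u (t *: v) = t * dotp u v.
Proof. by rewrite dotpC dotpZl dotpC. Qed.

Lemma dotpNl u v : dotp (- u) v = - dotp u v.
Proof. by rewrite -scaleN1r dotpZl mulN1r. Qed.

Lemma dotpNr u v : dotp u (- v) = - dotp u v.
Proof. by rewrite dotpC dotpNl dotpC. Qed.

Lemma dotp0l u : dotp 0 u = 0.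
Proof. by rewrite -(scale0r u) dotpZl mul0r. Qed.

Definition dotpE := (dotpDl, dotpDr, dotpNl, dotpNr, dotpZl, dotpZr).

Lemma dotp_suml (I : Type) (r : seq I) (F : I -> 'rV[R]_d) v :
  dotp (\sum_(i <- r) F i) v = \sum_(i <- r) dotp (F i) v.
Proof.
elim: r => [|i r IHr]; first by rewrite !big_nil dotp0l.
by rewrite !big_cons dotpDl IHr.
Qed.

Lemma dotp_ge0 v : 0 <= dotp v v.
Proof. by apply: sumr_ge0 => j _; rewrite -expr2 sqr_ge0. Qed.

Lemma sqr_enorm v : enorm v ^+ 2 = dotp v v.
Proof. by rewrite sqr_sqrtr ?dotp_ge0. Qed.

Lemma enormZ t v : enorm (t *: v) = `|t| * enorm v.
Proof.
by rewrite /enorm dotpZl dotpZr mulrA -expr2 sqrtrM ?sqr_ge0 ?sqrtr_sqr.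
Qed.

Lemma normr_coord v (j : 'I_d) : `|v ord0 j| <= `|v|.
Proof.
rewrite [leRHS]/Num.norm /= mx_normrE.
by apply/bigmax_geP; right; exists (ord0, j).
Qed.

Lemma normr_row_le v t :
  0 <= t -> (forall j, `|v ord0 j| <= t) -> `|v| <= t.
Proof.
move=> t0 vt; rewrite [leLHS]/Num.norm /= mx_normrE; apply/bigmax_leP.
by split=> // -[i j] _ /=; rewrite ord1.
Qed.

Lemma sqr_normr_le_dotp v : `|v| ^+ 2 <= dotp v v.
Proof.
rewrite -[leRHS]sqr_sqrtr ?dotp_ge0// ler_sqr ?nnegrE ?sqrtr_ge0 ?normr_ge0//.
apply: normr_row_le => [|j]; first exact: sqrtr_ge0.
rewrite -sqrtr_sqr ler_sqrt ?dotp_ge0// /dotp (bigD1 j)//= expr2 lerDl.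
by apply: sumr_ge0 => k _; rewrite -expr2 sqr_ge0.
Qed.

Lemma normr_dotp_le u v : `|dotp u v| <= d%:R * `|u| * `|v|.
Proof.
apply: le_trans (ler_norm_sum _ _ _) _.
apply: le_trans (ler_sum _ (G := fun _ => `|u| * `|v|) _) _ => [j _|].
  by rewrite normrM ler_pM// normr_coord.
by rewrite sumr_const card_ord -[leLHS]mulr_natl mulrA.
Qed.

Lemma dotp_le_sqr_normr v : dotp v v <= d%:R * `|v| ^+ 2.
Proof.
apply: le_trans (ler_norm _) _; apply: le_trans (normr_dotp_le v v) _.
by rewrite -mulrA -expr2.
Qed.

Lemma dotp_convex_comb (m : nat) (w : 'I_m -> R) (z : 'I_m -> 'rV[R]_d) :
  (forall j, 0 <= w j) -> \sum_(j < m) w j = 1 ->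
  dotp (\sum_(j < m) w j *: z j) (\sum_(j < m) w j *: z j)
    <= \sum_(j < m) w j * dotp (z j) (z j).
Proof.
move=> w0 w1; set s := \sum_(j < m) w j *: z j.
have s2 : \sum_(j < m) w j * dotp (z j) s = dotp s s.
  by rewrite {2}/s dotp_suml; apply: eq_bigr => j _; rewrite dotpZl.
have : 0 <= \sum_(j < m) w j * dotp (z j - s) (z j - s).
  by apply: sumr_ge0 => j _; rewrite mulr_ge0// dotp_ge0.
rewrite (eq_bigr (fun j => w j * dotp (z j) (z j)
    - (w j * dotp (z j) s + w j * dotp (z j) s) + w j * dotp s s)) => [|j _].
  by rewrite big_split/= sumrB big_split/= s2 -mulr_suml w1; lra.
by rewrite !dotpE (dotpC s (z j)); ring.
Qed.

End dotp.

Lemma rV_continuousP {R : realType} {d : nat} (h : 'rV[R]_d -> R) :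
  (forall x r, 0 < r ->
    exists2 e, 0 < e & forall y, `|x - y| < e -> `|h x - h y| < r) ->
  continuous h.
Proof.
move=> hc x; apply/(cvgrPdist_lt (FF := nbhs_filter x)) => r r0.
have [e e0 he] := hc x r r0.
by apply/nbhs_ballP; exists e => //= y; rewrite mx_norm_ball; exact: he.
Qed.

Section convex_functions.
Context {R : realType} {d : nat}.
Implicit Types (h : 'rV[R]_d -> R) (x y u : 'rV[R]_d).

Lemma convex_functionP h : convex_function setT h ->
  forall x y (t : R), 0 <= t -> t <= 1 ->
  h (t *: x + (1 - t) *: y) <= t * h x + (1 - t) * h y.
Proof.
move=> ch x y t t0 t1.
have := ch (Itv01 t0 t1) x y; rewrite !in_setT => /(_ isT isT).
by rewrite convRE.
Qed.

Lemma convex_line_bound h x u : convex_function setT h ->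
  exists2 C, 0 <= C & forall t, `|t| <= 1 -> h (x + t *: u) <= h x + C * `|t|.
Proof.
move=> /convex_functionP ch.
exists (`|h (x + u) - h x| + `|h (x - u) - h x|) => [|t t1].
  by rewrite addr_ge0.
have [t0|/ltW t0] := leP 0 t.
  rewrite ger0_norm// in t1 *.
  have := ch (x + u) x t t0 t1.
  have -> : t *: (x + u) + (1 - t) *: x = x + t *: u.
    by apply/rowP => j; rewrite !mxE; ring.
  have := ler_norm (h (x + u) - h x); have := normr_ge0 (h (x - u) - h x); nra.
rewrite ler0_norm// in t1 *.
have := ch (x - u) x (- t); rewrite oppr_ge0 => /(_ t0 t1).
have -> : (- t) *: (x - u) + (1 - - t) *: x = x + t *: u.
  by apply/rowP => j; rewrite !mxE; ring.
have := ler_norm (h (x - u) - h x); have := normr_ge0 (h (x + u) - h x); nra.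
Qed.

Lemma convex_local_bound h x (s : seq 'I_d) : convex_function setT h ->
  exists C e : R, [/\ 0 <= C, 0 < e & forall u, `|u| <= e ->
    h (x + \sum_(j <- s) u ord0 j *: delta_mx ord0 j) <= h x + C * `|u|].
Proof.
move=> ch; elim: s => [|j s [C [e [C0 e0 IHs]]]].
  exists 0, 1; split=> // u _; rewrite big_nil addr0 mul0r addr0 //.
have [D D0 hD] := convex_line_bound h x (delta_mx ord0 j) ch.
exists (C + D), (Num.min e 1 / 2).
have m0 : 0 < Num.min e 1 by rewrite lt_min e0 ltr01.
split=> [||u]; [exact: addr_ge0|exact: divr_gt0|rewrite ler_pdivlMr// => ue].
have := ue; rewrite le_min => /andP[ue1 ue2].
have n2u : `|2 *: u| = `|u| * 2 by rewrite normrZ ger0_norm// mulrC.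
have h1 := IHs (2 *: u); rewrite n2u in h1; have {}h1 := h1 ue1.
have h2 := hD (2 * u ord0 j).
have n2 : `|2 * u ord0 j| = `|u ord0 j| * 2 by rewrite normrM ger0_norm// mulrC.
have uj := normr_coord u j.
rewrite n2 in h2; have {}h2 : h (x + (2 * u ord0 j) *: delta_mx ord0 j) <=
    h x + D * (`|u ord0 j| * 2) by apply: h2; lra.
have half0 : (0 : R) <= 2^-1 by rewrite invr_ge0.
have half1 : (2^-1 : R) <= 1 by rewrite invf_le1 ?ler1n.
have := convex_functionP _ ch
  (x + \sum_(i <- s) (2 *: u) ord0 i *: delta_mx ord0 i)
  (x + (2 * u ord0 j) *: delta_mx ord0 j) 2^-1 half0 half1.
set y := _ *: _ + _ *: _.
have -> : y = x + \sum_(i <- j :: s) u ord0 i *: delta_mx ord0 i.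
  rewrite /y big_cons.
  have -> : \sum_(i <- s) (2 *: u) ord0 i *: (delta_mx ord0 i : 'rV[R]_d) =
      2 *: \sum_(i <- s) u ord0 i *: delta_mx ord0 i.
    by rewrite scaler_sumr; apply: eq_bigr => i _; rewrite mxE scalerA.
  by apply/rowP => i; rewrite !mxE; field.
move=> /le_trans; apply.
have : D * `|u ord0 j| <= D * `|u| by rewrite ler_wpM2l.
lra.
Qed.

Lemma convex_continuous h : convex_function setT h -> continuous h.
Proof.
move=> ch; apply: rV_continuousP => x r r0.
have [C [e [C0 e0 hC]]] := convex_local_bound h x (index_enum _) ch.
have {}hC u : `|u| <= e -> h (x + u) <= h x + C * `|u|.
  by move=> /hC; rewrite -row_sum_delta.
have hC' u : `|u| <= e -> `|h x - h (x + u)| <= C * `|u|.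
  move=> ue; have h1 := hC u ue; have h2 := hC (- u); rewrite normrN in h2.
  have {}h2 := h2 ue.
  have half0 : (0 : R) <= 2^-1 by rewrite invr_ge0.
  have half1 : (2^-1 : R) <= 1 by rewrite invf_le1 ?ler1n.
  have := convex_functionP _ ch (x + u) (x - u) 2^-1 half0 half1.
  have -> : 2^-1 *: (x + u) + (1 - 2^-1) *: (x - u) = x.
    by apply/rowP => i; rewrite !mxE; field.
  by rewrite ler_norml; lra.
exists (Num.min e (r / (C + 1))).
  by rewrite lt_min e0 divr_gt0//; lra.
move=> y; rewrite distrC lt_min => /andP[/ltW ye yr].
have := hC' (y - x) ye; rewrite addrCA subrr addr0 => /le_lt_trans; apply.
have C1 : 0 < C + 1 by lra.
move: yr; rewrite ltr_pdivlMr// => /le_lt_trans -> //.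
by rewrite mulrC ler_wpM2l//; lra.
Qed.

End convex_functions.

(** * The dual function and existence of dual optima *)

Lemma bounded_cluster {R : realType} {d : nat} (u : nat -> 'rV[R]_d) (M : R) :
  (forall k j, `|u k ord0 j| <= M) ->
  exists2 l : 'rV[R]_d, (forall j, `|l ord0 j| <= M) &
    forall e, 0 < e -> forall N, exists2 k, (N <= k)%N & `|u k - l| < e.
Proof.
move=> uM.
have cK := @rV_compact R d (fun=> `[- M, M]%classic)
  (fun=> @segment_compact R (- M) M).
have [|l [/= lK cl]] := cK (u @ \oo) _.
  by exists 0 => // k _ j /=; rewrite in_itv /= -ler_norml.
exists l => [j|e e0 N]; first by have := lK j; rewrite /= in_itv /= -ler_norml.
have [_ [[k Nk <-]]] := cl (u @` [set k | (N <= k)%N]) (ball l e)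
  (ex_intro2 _ _ N I (fun k Nk => ex_intro2 _ _ k Nk erefl))
  (nbhsx_ballx l e e0).
by rewrite mx_norm_ball /ball_ /= distrC => lk; exists k.
Qed.

Section local_dual.
Context {R : realType} {m p : nat} {n : 'I_m -> nat}.
Variables (X : forall i, set 'rV[R]_(n i)).
Variables (f : forall i, 'rV[R]_(n i) -> R).
Variables (g : forall i, 'rV[R]_(n i) -> 'rV[R]_p).
Hypotheses (convXfg : convexity X f g) (compX : compactness X).
Hypothesis X0 : forall i, X i !=set0.

Local Notation L := (lagrangian f g).
Local Notation phi := (phi X f g).

Lemma lagrangian_continuous i lam : continuous (L i lam).
Proof.
have [cf cg _] := convXfg i.
move=> x; have hf := convex_continuous _ cf x.
refine (@continuousD _ _ _ (f i) (fun y => dotp lam (g i y)) x hf _).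
rewrite /continuous_at /dotp.
apply: (@cvg_big _ _ _ _ _ add_continuous _ (nbhs x) _ _ _ (nbhs_filter x)).
move=> j _.
have hg := convex_continuous _ (cg j) x.
refine (@continuousM _ _ (fun=> lam ord0 j) (fun y => g i y ord0 j) x _ hg).
exact: cst_continuous.
Qed.

Lemma argmin_exists i lam : exists x, argmin (X i) (L i lam) x.
Proof.
have [x xX xmin] := EVT_min_rV (X0 i) (compX i)
  (continuous_subspaceT (@lagrangian_continuous i lam)).
exists x; split; first exact/set_mem.
by move=> y yX; apply: xmin; exact/mem_set.
Qed.

Lemma phiE i lam x : argmin (X i) (L i lam) x -> phi i lam = L i lam x.
Proof.
move=> [xX xmin]; rewrite /phi /minval.
have [[y yX <-] lb] : ((L i lam @` X i) `&` lbound (L i lam @` X i))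
    (get ((L i lam @` X i) `&` lbound (L i lam @` X i))).
  apply: getPex; exists (L i lam x); split; first by exists x.
  by move=> _ [y yX <-]; exact: xmin.
by apply/le_anti; rewrite xmin// lb//; exists x.
Qed.

Lemma phi_le i lam x : X i x -> phi i lam <= L i lam x.
Proof.
move=> xX; have [y [yX ymin]] := argmin_exists i lam.
by rewrite (phiE _ _ _ (conj yX ymin)) ymin.
Qed.

Lemma phi_supergradient i lam mu x : argmin (X i) (L i lam) x ->
  phi i mu <= phi i lam + dotp (g i x) (mu - lam).
Proof.
move=> xmin; have [xX _] := xmin; rewrite (phiE _ _ _ xmin).
apply: le_trans (phi_le i mu x xX) _.
by rewrite /lagrangian !dotpE !(dotpC (g i x)); lra.
Qed.

Lemma constraint_bounded :
  exists2 G, 0 <= G & forall i x, X i x -> `|g i x| <= G.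
Proof.
have gj i (j : 'I_p) : exists G, forall x, X i x -> `|g i x ord0 j| <= G.
  have [_ cg _] := convXfg i.
  have [x _ xmax] : exists2 x, x \in X i &
      forall t, t \in X i -> `|g i t ord0 j| <= `|g i x ord0 j|.
    apply: (@EVT_max_rV _ _ (fun t => `|g i t ord0 j|)) => //.
    apply: continuous_subspaceT => x; have hg := convex_continuous _ (cg j) x.
    exact: (continuous_comp hg (@norm_continuous R R _)).
  by exists `|g i x ord0 j| => y /mem_set/xmax.
have [G gG] := choice (fun ij : 'I_m * 'I_p => gj ij.1 ij.2).
exists (\sum_ij `|G ij|) => [|i x xX]; first exact: sumr_ge0.
apply: normr_row_le => [|j]; first exact: sumr_ge0.
apply: le_trans (gG (i, j) x xX) _; apply: le_trans (ler_norm _) _.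
by rewrite (bigD1 (i, j))//= lerDl sumr_ge0.
Qed.

Lemma phi_lipschitz i G lam mu : (forall x, X i x -> `|g i x| <= G) ->
  phi i mu <= phi i lam + p%:R * G * `|mu - lam|.
Proof.
move=> gG; have [x xmin] := argmin_exists i lam; have [xX _] := xmin.
apply: le_trans (phi_supergradient i lam mu x xmin) _; rewrite lerD2l.
apply: le_trans (ler_norm _) _; apply: le_trans (normr_dotp_le _ _) _.
by rewrite ler_wpM2r// ler_wpM2l// gG.
Qed.

End local_dual.

Section slater_direction.
Context {R : realType} {m p : nat} {n : 'I_m -> nat}.
Variables (X : forall i, set 'rV[R]_(n i)).
Variables (g : forall i, 'rV[R]_(n i) -> 'rV[R]_p).
Hypothesis slaterXg : slater X g.

Lemma slater_nonempty i : X i !=set0.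
Proof. by have [x [xX _] _] := slaterXg; exists (submxrow x i). Qed.

Lemma affine_function_extrapolate d (h : 'rV[R]_d -> R) x y (e : R) :
  affine_function h -> h (x + e *: (x - y)) = (1 + e) * h x - e * h y.
Proof. by move=> [u [b hE]]; rewrite !hE !dotpE; ring. Qed.

Lemma slater_direction (d : 'rV[R]_p) : orthant d ->
  (forall x, (forall i, X i (x i)) -> 0 <= dotp d (\sum_i g i (x i))) ->
  forall x, (forall i, X i (x i)) -> dotp d (\sum_i g i (x i)) = 0.
Proof.
move=> d0 H0.
pose H z := \sum_(j < p) d ord0 j * constraint g j z.
have HE z : dotp d (\sum_i g i (submxrow z i)) = H z.
  by apply: eq_bigr => j _; rewrite /constraint summxE.
have {}H0 z : product_set X z -> 0 <= H z by move=> zX; rewrite -HE H0.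
have [z [zX [e e0 zrel]] zs] := slaterXg.
have z0 j : d ord0 j * constraint g j z <= 0.
  rewrite mulr_ge0_le0//; have [zaff znaff] := zs j.
  by have [/zaff|/znaff/ltW] := pselect (affine_function (constraint g j)).
have Hz : H z = 0 by apply/le_anti; rewrite H0// andbT sumr_le0.
have zj j : d ord0 j * constraint g j z = 0.
  have /eqP : \sum_(j < p) - (d ord0 j * constraint g j z) = 0.
    by rewrite sumrN -/(H z) Hz oppr0.
  rewrite psumr_eq0 => [|k _]; last by rewrite oppr_ge0.
  by move=> /allP/(_ j); rewrite mem_index_enum oppr_eq0 => /(_ isT)/eqP.
have daff j : d ord0 j != 0 -> affine_function (constraint g j).
  move=> dj; apply: contrapT => /(zs j).2.
  have /eqP := zj j; rewrite mulf_eq0 (negPf dj)/= => /eqP ->.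
  by rewrite ltxx.
have Hext y t : H (z + t *: (z - y)) = (1 + t) * H z - t * H y.
  rewrite !mulr_sumr -sumrB; apply: eq_bigr => j _.
  have [->|/daff daffj] := eqVneq (d ord0 j) 0; first by ring.
  by rewrite affine_function_extrapolate//; ring.
have {}Hext y : product_set X y -> H y <= 0.
  move=> yX; pose t := e / (enorm (z - y) + 1).
  have n0 : 0 <= enorm (z - y) by exact: sqrtr_ge0.
  have n1 : 0 < enorm (z - y) + 1 by lra.
  have t0 : 0 < t by rewrite divr_gt0.
  have : 0 <= H (z + t *: (z - y)).
    apply: H0; apply: zrel.
      exists 2%N, (fun i : 'I_2 => if i == ord0 then z else y),
        (fun i : 'I_2 => if i == ord0 then 1 + t else - t).
      split=> [k||]; first by case: ifP.
        by rewrite !big_ord_recl big_ord0/=; ring.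
      by rewrite !big_ord_recl big_ord0/=; apply/rowP => j; rewrite !mxE; ring.
    rewrite addrAC subrr add0r enormZ gtr0_norm// /t -mulrA gtr_pMr//.
    by rewrite mulrC ltr_pdivrMr//; lra.
  by rewrite Hext Hz mulr0 add0r oppr_ge0 pmulr_rle0.
move=> x xX; have xE i : submxrow (\mxrow_i x i) i = x i by rewrite mxrowK.
have xX' : product_set X (\mxrow_i x i) by move=> i; rewrite xE.
have -> : \sum_i g i (x i) = \sum_i g i (submxrow (\mxrow_i x i) i).
  by apply: eq_bigr => i _; rewrite xE.
by rewrite HE; apply/le_anti; rewrite H0// Hext.
Qed.

End slater_direction.

Section dual_regularity.
Context {R : realType} {m p : nat} {n : 'I_m -> nat}.
Variables (X : forall i, set 'rV[R]_(n i)).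
Variables (f : forall i, 'rV[R]_(n i) -> R).
Variables (g : forall i, 'rV[R]_(n i) -> 'rV[R]_p).

Definition dual_function (lam : 'rV[R]_p) : R := \sum_(i < m) phi X f g i lam.

Hypotheses (convXfg : convexity X f g) (compX : compactness X).
Hypothesis slaterXg : slater X g.

Let X0 := slater_nonempty X g slaterXg.

Lemma dual_lipschitz : exists2 K, 0 <= K &
  forall lam mu, dual_function mu <= dual_function lam + K * `|mu - lam|.
Proof.
have [G G0 gG] := constraint_bounded X f g convXfg compX X0.
exists (\sum_(i < m) p%:R * G) => [|lam mu].
  by apply: sumr_ge0 => i _; rewrite mulr_ge0.
rewrite /dual_function mulr_suml -big_split/=; apply: ler_sum => i _.
by apply: phi_lipschitz => // x; exact: gG.
Qed.

Lemma dual_continuous : continuous dual_function.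
Proof.
have [K K0 DK] := dual_lipschitz.
apply: rV_continuousP => lam r r0; exists (r / (K + 1)).
  by rewrite divr_gt0//; lra.
move=> mu; rewrite ltr_pdivlMr => [h|]; last by lra.
have h1 := DK lam mu; have h2 := DK mu lam; rewrite (distrC mu) in h1.
have := normr_ge0 (lam - mu).
by rewrite ltr_norml; nra.
Qed.

Lemma dual_le lam x : (forall i, X i (x i)) ->
  dual_function lam <= \sum_i f i (x i) + dotp lam (\sum_i g i (x i)).
Proof.
move=> xX; rewrite /dual_function dotpC dotp_suml -big_split/=.
apply: ler_sum => i _.
by rewrite dotpC; exact: phi_le.
Qed.

Lemma dual_constancy (d : 'rV[R]_p) :
  (forall x, (forall i, X i (x i)) -> dotp d (\sum_i g i (x i)) = 0) ->
  forall lam t, dual_function lam <= dual_function (lam - t *: d).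
Proof.
move=> d0 lam t.
pose x i := get (argmin (X i) (lagrangian f g i (lam - t *: d))).
have xmin i : argmin (X i) (lagrangian f g i (lam - t *: d)) (x i).
  by apply: getPex; exact: argmin_exists.
apply: le_trans (dual_le lam x (fun i => (xmin i).1)) _.
have -> : dual_function (lam - t *: d) =
    \sum_i f i (x i) + dotp (lam - t *: d) (\sum_i g i (x i)).
  rewrite /dual_function dotpC dotp_suml -big_split/=; apply: eq_bigr => i _.
  by rewrite dotpC; exact: phiE.
by rewrite lerD2l !dotpE d0 ?mulr0 ?subr0// => i; case: (xmin i).
Qed.

Lemma dotp_continuous d : continuous (fun v : 'rV[R]_d => dotp v v).
Proof.
move=> x; rewrite /continuous_at /dotp.
apply: (@cvg_big _ _ _ _ _ add_continuous _ (nbhs x) _ _ _ (nbhs_filter x)).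
move=> j _.
have h := @coord_continuous R 1 d ord0 j x.
exact: (@continuousM _ _ (fun y : 'rV[R]_d => y ord0 j)
  (fun y => y ord0 j) x h h).
Qed.

Lemma regularized_dual (r eps : R) : 0 <= r -> exists lam : 'rV[R]_p,
  (forall j, 0 <= lam ord0 j <= r) /\
  forall mu : 'rV[R]_p, (forall j, 0 <= mu ord0 j <= r) ->
    dual_function mu - eps * dotp mu mu <=
    dual_function lam - eps * dotp lam lam.
Proof.
move=> r0; have cK := @rV_compact R p (fun=> `[0, r]%classic)
  (fun=> @segment_compact R 0 r).
have [||lam lK lmax] := @EVT_max_rV R p
    (fun lam => dual_function lam - eps * dotp lam lam) _ _ cK.
- by exists 0 => j /=; rewrite in_itv/= mxE lexx r0.
- apply: continuous_subspaceT => x.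
  refine (@continuousB _ _ _ dual_function
    (fun lam => eps * dotp lam lam) x (dual_continuous x) _).
  refine (@continuousM _ _ (fun=> eps)
    (fun lam => dotp lam lam) x _ (dotp_continuous p x)).
  exact: cst_continuous.
exists lam; split=> [j|mu muK].
  by move/set_mem: lK => /(_ j); rewrite /= in_itv.
by apply: lmax; apply/mem_set => j /=; rewrite in_itv; exact: muK.
Qed.

End dual_regularity.

Lemma dotp_lt_shrink {R : realType} {d : nat} (u v : 'rV[R]_d) (t : R) :
  0 < t -> orthant v -> v != 0 ->
  (forall j, t * v ord0 j <= u ord0 j) ->
  dotp (u - t *: v) (u - t *: v) < dotp u u.
Proof.
move=> t0 v0 vN0 vu.
have [k vk] : exists k, v ord0 k != 0.
  apply: contrapT => vE; move/eqP: vN0; apply; apply/rowP => j; rewrite mxE.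
  by apply: contrapT => /eqP vj; apply: vE; exists j.
have lej j : (u - t *: v) ord0 j * (u - t *: v) ord0 j <= u ord0 j * u ord0 j.
  have := mulr_ge0 (ltW t0) (v0 j); have := vu j; rewrite !mxE; nra.
rewrite /dotp (bigD1 k)//= [ltRHS](bigD1 k)//=; apply: ltr_leD.
  have vk0 : 0 < v ord0 k by rewrite lt0r vk v0.
  have := mulr_gt0 t0 vk0; have := vu k; rewrite !mxE; nra.
by apply: ler_sum => j _.
Qed.

Lemma orthant_limit {R : realType} {d : nat} (l : 'rV[R]_d) :
  (forall e, 0 < e -> exists2 u, orthant u & `|u - l| < e) -> orthant l.
Proof.
move=> ul j; apply/ler_addgt0Pr => e /ul[u u0 ue].
have := normr_coord (u - l) j; rewrite !mxE.
by have := u0 j; have := ler_norm (u ord0 j - l ord0 j); lra.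
Qed.

Section dual_attainment.
Context {R : realType} {m p : nat} {n : 'I_m -> nat}.
Variables (X : forall i, set 'rV[R]_(n i)).
Variables (f : forall i, 'rV[R]_(n i) -> R).
Variables (g : forall i, 'rV[R]_(n i) -> 'rV[R]_p).
Hypotheses (convXfg : convexity X f g) (compX : compactness X).
Hypothesis slaterXg : slater X g.
Local Notation dual_function := (dual_function X f g).

(* If the maximizers [lam r] of the regularized dual functions on growing boxes
   are unbounded, they escape along a direction [d] in which, by the Slater
   condition, the dual function is constant; moving from [lam r] against [d]
   then decreases the regularization term, contradicting maximality. *)
Lemma dual_optima_nonempty : dual_optima X f g !=set0.
Proof.
have [ep [ep0 ep1]] : exists ep : nat -> R,
    (forall r, 0 < ep r) /\ forall r, ep r * r%:R <= 1.
  exists (fun r => r.+1%:R^-1); split=> r; first by rewrite invr_gt0 ltr0n.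
  by rewrite mulrC ler_pdivrMr ?ltr0n// mul1r ler_nat.
have /choice[lam lamP] r :=
  regularized_dual X f g convXfg compX slaterXg r%:R (ep r) (ler0n _ _).
have [K K0 DK] := dual_lipschitz X f g convXfg compX slaterXg.
have Dle := dual_le X f g convXfg compX slaterXg.
have Dcst := dual_constancy X f g convXfg compX slaterXg.
rewrite -[dual_optima X f g]/(argmax orthant dual_function).
move: (dual_function) lamP DK Dle Dcst => D lamP DK Dle Dcst.
have lam0 r : orthant (lam r) by move=> j; have [/(_ j)/andP[]] := lamP r.
have [[M bM]|unb] := pselect (exists M, forall N, exists2 r, (N <= r)%N &
    forall j, lam r ord0 j <= M).
  have [s sN sM] : exists2 s : nat -> nat, (forall N, (N <= s N)%N) &
      forall N j, lam (s N) ord0 j <= M.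
    have /choice[s sP] : forall N, exists r, (N <= r)%N /\
        forall j, lam r ord0 j <= M.
      by move=> N; have [r Nr rM] := bM N; exists r.
    by exists s => N; case: (sP N).
  have [|l _ cl] := bounded_cluster (fun N => lam (s N)) M.
    by move=> N j; rewrite ger0_norm ?sM//; exact: lam0.
  exists l; split.
    apply: orthant_limit => e e0.
    by have [k _] := cl e e0 0%N; exists (lam (s k)).
  move=> mu mu0.
  suff dl (e : R) : 0 < e -> D mu <= D l + e by exact/ler_addgt0Pr.
  move=> e0.
  have e'0 : 0 < e / 2 / (K + 1) by rewrite !divr_gt0//; lra.
  pose q := `|mu| + dotp mu mu / (e / 2).
  have [k Nk kl] := cl _ e'0 (Num.Def.truncn q).+1.
  have qs : q < (s k)%:R.
    apply: lt_le_trans (truncnS_gt q) _.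
    by rewrite ler_nat (leq_trans Nk).
  have dq : 0 <= dotp mu mu / (e / 2) by rewrite divr_ge0 ?dotp_ge0//; lra.
  have mq : 0 <= `|mu| by [].
  have /(lamP (s k)).2 : forall j, 0 <= mu ord0 j <= (s k)%:R.
    move=> j; rewrite mu0/=; have := normr_coord mu j.
    by have := ler_norm (mu ord0 j); rewrite /q in qs; lra.
  have : ep (s k) * dotp mu mu <= e / 2.
    apply: (@le_trans _ _ (ep (s k) * ((s k)%:R * (e / 2)))).
      by rewrite ler_pM2l// -ler_pdivrMr; rewrite /q in qs; lra.
    by rewrite mulrA ler_piMl//; lra.
  have : 0 <= ep (s k) * dotp (lam (s k)) (lam (s k)).
    by rewrite mulr_ge0 ?dotp_ge0// ltW.
  have := DK l (lam (s k)).
  have : K * `|lam (s k) - l| <= e / 2.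
    rewrite ltr_pdivlMr in kl; last by lra.
    by have := normr_ge0 (lam (s k) - l); nra.
  lra.
exfalso.
have {}unb M : exists N, forall r, (N <= r)%N -> M < `|lam r|.
  apply: contrapT => h; apply: unb; exists M => N; apply: contrapT => hN.
  apply: h; exists N => r Nr; rewrite ltNge; apply/negP => lM.
  apply: hN; exists r => // j; apply: le_trans lM.
  by apply: le_trans (normr_coord _ j); exact: ler_norm.
pose v r := `|lam r|^-1 *: lam r.
have [|d _ cl] := bounded_cluster v 1.
  move=> r j; rewrite mxE normrM normfV normr_id.
  have [->|n0] := eqVneq `|lam r| 0; first by rewrite invr0 mul0r.
  by rewrite mulrC ler_pdivrMr ?mul1r ?normr_coord// lt0r n0/=.
have {}cl e M : 0 < e ->
    exists r, [/\ M < `|lam r|, 0 < `|lam r| & `|v r - d| < e].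
  move=> e0; have [N hN] := unb (Num.max M 0); have [r Nr rd] := cl e e0 N.
  by exists r; have := hN r Nr; rewrite gt_max => /andP[-> ->].
have d0 : orthant d.
  apply: orthant_limit => e e0; have [r [_ _ re]] := cl e 0 e0.
  by exists (v r) => // j; rewrite mxE mulr_ge0 ?invr_ge0//; exact: lam0.
have dN0 : d != 0.
  apply/eqP => dE; have [r [_ r0]] := cl 1 0 ltr01.
  by rewrite dE subr0 normrZ normfV normr_id mulVf ?ltxx// gt_eqF.
have Hd x : (forall i, X i (x i)) -> 0 <= dotp d (\sum_i g i (x i)).
  move=> xX; set w := \sum_i g i (x i).
  apply/ler_addgt0Pr => e e0.
  pose A := `|D 0 - \sum_i f i (x i)|.
  have p0 : 0 <= p%:R * `|w| by rewrite mulr_ge0.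
  have e'0 : 0 < e / 2 / (p%:R * `|w| + 1) by rewrite !divr_gt0//; lra.
  have [r [rA r0 re]] := cl (e / 2 / (p%:R * `|w| + 1)) (A / (e / 2)) e'0.
  have h1 : D 0 <= D (lam r).
    have /(lamP r).2 : forall j : 'I_p, 0 <= (0 : 'rV[R]_p) ord0 j <= r%:R.
      by move=> j; rewrite mxE lexx ler0n.
    rewrite dotp0l mulr0 subr0.
    have : 0 <= ep r * dotp (lam r) (lam r) by rewrite mulr_ge0 ?dotp_ge0// ltW.
    lra.
  have h2 := Dle (lam r) x xX.
  have lamE : lam r = `|lam r| *: v r.
    by rewrite scalerA mulfV ?scale1r// gt_eqF.
  rewrite lamE dotpZl -lamE -/w in h2.
  have h3 : dotp (v r) w <= dotp d w + e / 2.
    have -> : dotp (v r) w = dotp d w + dotp w (v r - d).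
      by rewrite !dotpE !(dotpC w); ring.
    rewrite lerD2l; apply: le_trans (ler_norm _) _.
    apply: le_trans (normr_dotp_le _ _) _.
    rewrite ltr_pdivlMr in re; last by lra.
    by have := normr_ge0 (v r - d); nra.
  have h4 : - (e / 2) < dotp (v r) w.
    rewrite -(ltr_pM2l r0); rewrite ltr_pdivrMr in rA; last by lra.
    have := ler_norm (- (D 0 - \sum_i f i (x i))); rewrite normrN -/A.
    lra.
  lra.
pose e := \big[Num.min/1]_(j | 0 < d ord0 j) (d ord0 j / 2).
have e0 : 0 < e by apply: lt_bigmin => // j dj; rewrite divr_gt0.
have [r [_ r0 re]] := cl e 0 e0.
pose t := `|lam r| / 2.
have t0 : 0 < t by rewrite divr_gt0.
have tle j : t * d ord0 j <= lam r ord0 j.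
  have [dj|dj] := ltP 0 (d ord0 j); last first.
    by apply: le_trans (lam0 r j); rewrite pmulr_rle0.
  have ej : e <= d ord0 j / 2 by exact: bigmin_le_cond.
  have := le_lt_trans (normr_coord (v r - d) j) (lt_le_trans re ej).
  rewrite !mxE ltr_norml => /andP[h _].
  have -> : lam r ord0 j = `|lam r| * (`|lam r|^-1 * lam r ord0 j).
    by rewrite mulrA mulfV ?mul1r// gt_eqF.
  by rewrite /t -mulrA ler_pM2l//; lra.
have := dotp_lt_shrink (lam r) d t t0 d0 dN0 tle.
have /(lamP r).2 : forall j, 0 <= (lam r - t *: d) ord0 j <= r%:R.
  move=> j; rewrite !mxE subr_ge0 tle/=.
  have [/(_ j)/andP[_ lr] _] := lamP r.
  by have := mulr_ge0 (ltW t0) (d0 j); lra.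
have := Dcst d
  (slater_direction X g slaterXg d d0 Hd) (lam r) t.
move=> h1 h2 h3.
have : 0 < ep r * (dotp (lam r) (lam r)
    - dotp (lam r - t *: d) (lam r - t *: d)).
  by rewrite mulr_gt0 // subr_gt0.
lra.
Qed.

End dual_attainment.

(** * Consensus *)

Section averaging.
Context {R : realType} {m p : nat}.
Implicit Types (W : 'I_m -> 'I_m -> R) (z r : 'I_m -> 'rV[R]_p).

Definition doubly_stochastic W : Prop :=
  [/\ forall i j, 0 <= W i j, forall i, \sum_j W i j = 1
    & forall j, \sum_i W i j = 1].

Definition mix W z i : 'rV[R]_p := \sum_j W i j *: z j.

Definition avg z : 'rV[R]_p := m%:R^-1 *: \sum_i z i.

Definition sum_norm z : R := \sum_i `|z i|.

Definition disagreement z : R := sum_norm (fun i => z i - avg z).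

Lemma disagreement_ge0 z : 0 <= disagreement z.
Proof. exact: sumr_ge0. Qed.

Lemma avgD z r : avg (fun i => z i + r i) = avg z + avg r.
Proof. by rewrite /avg big_split scalerDr. Qed.

Lemma sum_sub_avg z : \sum_i (z i - avg z) = 0.
Proof.
rewrite sumrB sumr_const card_ord -[X in _ - X]scaler_nat scalerA.
case: m z => [|m'] z; first by rewrite big_ord0 mul0r scale0r subrr.
by rewrite mulfV ?pnatr_eq0// scale1r subrr.
Qed.

Lemma sum_mix W z : (forall j, \sum_i W i j = 1) ->
  \sum_i mix W z i = \sum_i z i.
Proof.
move=> W1; rewrite exchange_big; apply: eq_bigr => j _.
by rewrite -scaler_suml W1 scale1r.
Qed.

Lemma sum_norm_mix W z : doubly_stochastic W ->
  sum_norm (mix W z) <= sum_norm z.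
Proof.
move=> [W0 _ W1].
apply: (@le_trans _ _ (\sum_i \sum_j W i j * `|z j|)).
  apply: ler_sum => i _; apply: le_trans (ler_norm_sum _ _ _) _.
  by apply: ler_sum => j _; rewrite normrZ ger0_norm.
rewrite exchange_big; apply: ler_sum => j _.
by rewrite -mulr_suml W1 mul1r.
Qed.

(* As the deviations from the average sum to zero, a constant [al] can be
   subtracted from all the weights without changing the mixture. *)
Lemma disagreement_mix W z (al : R) : doubly_stochastic W ->
  (forall i j, al <= W i j) ->
  disagreement (mix W z) <= (1 - m%:R * al) * disagreement z.
Proof.
move=> [_ W1 W2] alW.
have mixE i : mix W z i - avg (mix W z) =
    \sum_j (W i j - al) *: (z j - avg z).
  rewrite {1}/avg (sum_mix _ _ W2) -/(avg z).
  under eq_bigr do rewrite scalerBl scalerBr.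
  rewrite sumrB -scaler_sumr sum_sub_avg scaler0 subr0 sumrB.
  by rewrite -scaler_suml W1 scale1r.
apply: (@le_trans _ _ (\sum_i \sum_j (W i j - al) * `|z j - avg z|)).
  apply: ler_sum => i _; rewrite mixE; apply: le_trans (ler_norm_sum _ _ _) _.
  by apply: ler_sum => j _; rewrite normrZ ger0_norm// subr_ge0.
rewrite exchange_big mulr_sumr; apply: ler_sum => j _.
by rewrite -mulr_suml sumrB W2 sumr_const card_ord mulr_natl.
Qed.

Lemma disagreement_perturb z r :
  disagreement (fun i => z i + r i) <= disagreement z + 2 * sum_norm r.
Proof.
have avg_le : m%:R * `|avg r| <= sum_norm r.
  have [->|m0] := eqVneq (m%:R : R) 0; first by rewrite mul0r sumr_ge0.
  by rewrite normrZ ger0_norm ?invr_ge0// mulrA mulfV// mul1r ler_norm_sum.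
apply: (@le_trans _ _ (\sum_i (`|z i - avg z| + (`|r i| + `|avg r|)))).
  apply: ler_sum => i _; rewrite avgD opprD addrACA.
  by apply: le_trans (ler_normD _ _) _; rewrite lerD2l ler_normB.
rewrite big_split lerD2l big_split/= sumr_const card_ord -[X in _ + X]mulr_natl.
by move: avg_le; rewrite /sum_norm; lra.
Qed.

Fixpoint transition (a : nat -> 'I_m -> 'I_m -> R) (k s : nat) :
    'I_m -> 'I_m -> R :=
  if s is s'.+1 then
    fun i j => \sum_l a (k + s')%N i l * transition a k s' l j
  else fun i j => (i == j)%:R.

Variable a : nat -> 'I_m -> 'I_m -> R.
Hypothesis dsa : forall k, doubly_stochastic (a k).

Lemma transition_doubly_stochastic k s : doubly_stochastic (transition a k s).
Proof.
elim: s => [|s [t0 t1 t2]] /=.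
  split=> [i j|i|j]; first exact: ler0n.
    rewrite (bigD1 i)//= eqxx big1 ?addr0// => j ji.
    by rewrite eq_sym (negPf ji).
  by rewrite (bigD1 j)//= eqxx big1 ?addr0// => i /negPf ->.
have [a0 a1 a2] := dsa (k + s); split=> [i j|i|j].
- by apply: sumr_ge0 => l _; rewrite mulr_ge0.
- rewrite exchange_big -[RHS](a1 i); apply: eq_bigr => l _.
  by rewrite -mulr_sumr t1 mulr1.
- rewrite exchange_big -[RHS](t2 j); apply: eq_bigr => l _.
  by rewrite -mulr_suml a2 mul1r.
Qed.

Lemma transition_unroll (z e : nat -> 'I_m -> 'rV[R]_p) k :
  (forall k i, z k.+1 i = mix (a k) (z k) i + e k i) -> forall s,
  exists2 r, sum_norm r <= \sum_(t < s) sum_norm (e (k + t)%N) &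
    forall i, z (k + s)%N i = mix (transition a k s) (z k) i + r i.
Proof.
move=> zE; elim=> [|s [r rle zs]].
  exists (fun=> 0) => [|i].
    by rewrite big_ord0 /sum_norm big1// => i _; rewrite normr0.
  rewrite addn0 addr0 /mix (bigD1 i)//= eqxx scale1r big1 ?addr0// => j ji.
  by rewrite eq_sym (negPf ji) scale0r.
exists (fun i => mix (a (k + s)%N) r i + e (k + s)%N i) => [|i].
  rewrite big_ord_recr/=.
  apply: (@le_trans _ _
    (sum_norm (mix (a (k + s)%N) r) + sum_norm (e (k + s)%N))).
    by rewrite /sum_norm -big_split; apply: ler_sum => i _; exact: ler_normD.
  by rewrite lerD2r; apply: le_trans (sum_norm_mix _ _ _) rle.
rewrite addnS zE addrA; congr (_ + _).
rewrite /mix; under eq_bigr do rewrite zs scalerDr.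
rewrite big_split; congr (_ + _); rewrite /mix/=.
under eq_bigr do rewrite scaler_sumr.
rewrite exchange_big; apply: eq_bigr => j _.
by rewrite scaler_suml; apply: eq_bigr => l _; rewrite scalerA.
Qed.

End averaging.

Lemma connect_crossing {T : finType} (e : rel T) (S : {set T}) x y :
  connect e x y -> x \in S -> y \notin S ->
  exists u v, [/\ u \in S, v \notin S & e u v].
Proof.
move=> /connectP[s]; elim: s x => [|v s IHs] x /= => [_ -> xS /negP//|].
move=> /andP[xv vs] yE xS yS.
have [vS|vS] := boolP (v \in S); first exact: IHs v vs yE vS yS.
by exists x, v.
Qed.

Section transition_positivity.
Context {R : realType} {m : nat}.
Variable a : nat -> 'I_m -> 'I_m -> R.
Hypotheses (wa : weights a) (ca : connectivity a).

Lemma weights_doubly_stochastic k : doubly_stochastic (a k).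
Proof.
have [[eta [_ aP]] asum] := wa; have [a1 a2] := asum k.
by split=> // i j; have [/andP[]] := aP i j k.
Qed.

Lemma transition_positive : exists B (al : R), 0 < al /\
  forall k i j, al <= transition a k B i j.
Proof.
have [[eta [/andP[eta0 _] aP]] _] := wa; have [conn [T T0 TP]] := ca.
exists (m * T)%N, (eta ^+ (m * T)); split=> [|k i j]; first exact: exprn_gt0.
pose S s := [set i | eta ^+ s <= transition a k s i j]%SET.
have step s u v : u \in S s -> 0 < a (k + s)%N v u -> v \in S s.+1.
  rewrite !inE => us vu; have [_ _ /(_ vu) eta_le] := aP v u (k + s)%N.
  rewrite exprS /= (bigD1 u)//=.
  apply: (@le_trans _ _ (a (k + s)%N v u * transition a k s u j)).
    by rewrite ler_pM// ?exprn_ge0// ltW.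
  have [t0 _ _] := transition_doubly_stochastic a weights_doubly_stochastic k s.
  have [a0 _ _] := weights_doubly_stochastic (k + s).
  by rewrite lerDl sumr_ge0// => l _; rewrite mulr_ge0.
have Smono s t : (s <= t)%N -> S s \subset S t.
  move=> /subnK <-; elim: (t - s)%N => [|d IHd]; first by rewrite add0n.
  apply: (fintype.subset_trans IHd); apply/fintype.subsetP => u us.
  apply: (step _ u) => //.
  by have [_ au _] := aP u u (k + (d + s))%N; exact: lt_le_trans au.
have grow r : (minn m r.+1 <= #|S (r * T)%N|)%N.
  elim: r => [|r IHr].
    have jS : j \in S (0 * T)%N by rewrite inE mul0n /= eqxx.
    by rewrite (leq_trans (geq_minr _ _))// (cardD1 j) jS.
  have sub : S (r * T)%N \subset S (r.+1 * T)%N.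
    by rewrite Smono// mulSn leq_addl.
  have [full|[v vS]] :
      S (r * T)%N = [set: 'I_m]%SET \/ exists v, v \notin S (r * T)%N.
    have [/eqP|] := boolP (S (r * T)%N == [set: 'I_m]%SET); first by left.
    rewrite finset.eqEsubset finset.subsetT/= => /fintype.subsetPn[v _ vS].
    by right; exists v.
    move: sub; rewrite full => /subset_leq_card; rewrite cardsT card_ord.
    exact: leq_trans (geq_minl _ _).
  have jS : j \in S (r * T)%N.
    by apply: (fintype.subsetP (Smono 0%N _ _)) => //; rewrite inE /= eqxx.
  have [u [w [uS wS uw]]] := connect_crossing _ _ _ _ (conn j v) jS vS.
  have [l /andP[kl lk] ul] := TP u w uw (k + r * T)%N.
  have wS' : w \in S (r.+1 * T)%N.
    apply: (fintype.subsetP (Smono (l - k).+1 _ _)).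
      by rewrite mulSn; lia.
    apply: (step _ u); last by rewrite subnKC//; lia.
    by apply: (fintype.subsetP (Smono (r * T)%N _ _)) uS; lia.
  have : (#|S (r * T)%N| < #|S (r.+1 * T)%N|)%N.
    apply: proper_card; rewrite fintype.properE sub.
    by apply/fintype.subsetPn; exists w.
  by move: IHr; lia.
have : S (m * T)%N = [set: 'I_m]%SET.
  apply/eqP; rewrite eqEcard finset.subsetT cardsT card_ord.
  by apply: leq_trans (grow m); rewrite leq_min leqnn leqnSn.
by move=> /finset.setP/(_ i); rewrite !inE.
Qed.

End transition_positivity.

(** * Real sequences *)

Section real_sequences.
Context {R : realType}.
Implicit Types (b c q s w : nat -> R).

Lemma contraction_weighted_summable c q (B : nat) (rho D C : R) :
  (forall k, 0 <= c k) -> {homo c : k l / (k <= l)%N >-> l <= k} ->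
  (forall K, \sum_(k < K) c k ^+ 2 <= C) ->
  (forall k, 0 <= q k) -> 0 <= rho -> rho < 1 -> 0 <= D ->
  (forall k, q (B + k)%N <= rho * q k + D * \sum_(t < B) c (k + t)%N) ->
  exists M, forall K, \sum_(k < K) c k * q k <= M.
Proof.
move=> c0 cmono cC q0 rho0 rho1 D0 qB.
pose P K := \sum_(k < K) c k * q k.
have cq0 k : 0 <= c k * q k by rewrite mulr_ge0.
exists ((P B + D * (\sum_(t < B) C)) / (1 - rho)) => K; rewrite -/(P K).
rewrite ler_pdivlMr ?subr_gt0//.
have shift : \sum_(k < K) c (B + k)%N * q (B + k)%N <=
    rho * P K + D * \sum_(k < K) \sum_(t < B) c (k + t)%N ^+ 2.
  rewrite /P !mulr_sumr -big_split; apply: ler_sum => k _ /=.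
  apply: le_trans (ler_wpM2l (c0 _) (qB k)) _.
  rewrite mulrDr; apply: lerD.
    have := cmono k (B + k)%N (leq_addl _ _); have := mulr_ge0 rho0 (q0 k).
    by move=> h1 h2; have := ler_wpM2r h1 h2; lra.
  rewrite mulrCA ler_wpM2l// mulr_sumr; apply: ler_sum => t _.
  by rewrite expr2 ler_wpM2r// cmono// addnC leq_add2r ltnW.
have sq : \sum_(k < K) \sum_(t < B) c (k + t)%N ^+ 2 <= \sum_(t < B) C.
  rewrite exchange_big; apply: ler_sum => t _ /=.
  apply: le_trans (cC (t + K)%N); rewrite big_split_ord /=.
  rewrite -[leLHS]add0r lerD ?sumr_ge0// => [i _|]; first exact: sqr_ge0.
  by apply: ler_sum => k _; rewrite addnC.
have PBK : P K <= P B + \sum_(k < K) c (B + k)%N * q (B + k)%N.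
  have <- : P (B + K)%N = P B + \sum_(k < K) c (B + k)%N * q (B + k)%N.
    by rewrite /P big_split_ord.
  by rewrite addnC /P big_split_ord /= lerDl sumr_ge0.
by have := ler_wpM2l D0 sq; lra.
Qed.

Lemma weighted_summable_liminf0 c w (M : R) :
  (forall k, 0 < c k) -> (forall A, exists K, A < \sum_(k < K) c k) ->
  (forall k, 0 <= w k) -> (forall K, \sum_(k < K) c k * w k <= M) ->
  forall e, 0 < e -> forall N, exists2 k, (N <= k)%N & w k < e.
Proof.
move=> c0 cdiv w0 cw e e0 N; apply: contrapT => h.
have {}h k : (N <= k)%N -> e <= w k.
  by move=> Nk; rewrite leNgt; apply/negP => wk; apply: h; exists k.
have [K] := cdiv (M / e + \sum_(k < N) c k); apply/negP; rewrite -leNgt.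
suff : e * \sum_(k < K) c k <= \sum_(k < K) c k * w k + e * \sum_(k < N) c k.
  move=> /le_trans/(_ (lerD (cw K) (lexx _))).
  by rewrite -ler_pdivlMl// mulrDr mulKf ?gt_eqF// mulrC.
elim: K => [|K IHK].
  rewrite !big_ord0 mulr0 add0r mulr_ge0 ?(ltW e0)//.
  by apply: sumr_ge0 => i _; exact: ltW.
rewrite !big_ord_recr/=; have [NK|KN] := leqP N K.
  by have := ler_wpM2l (ltW (c0 K)) (h K NK); lra.
have [d dE] : exists d, N = (K.+1 + d)%N by exists (N - K.+1)%N; rewrite subnKC.
have -> : \sum_(k < N) c k =
    \sum_(k < K) c k + c K + \sum_(k < d) c (K.+1 + k)%N.
  by rewrite dE big_split_ord/= big_ord_recr.
have h1 : 0 <= \sum_(k < d) c (K.+1 + k)%N.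
  by apply: sumr_ge0 => i _; exact: ltW.
have h2 : 0 <= \sum_(k < K) c k * w k.
  by apply: sumr_ge0 => i _; rewrite mulr_ge0// ltW.
have h3 : 0 <= c K * w K by rewrite mulr_ge0// ltW.
by have := mulr_ge0 (ltW e0) h1; lra.
Qed.

Lemma quasi_monotone_cvg0 s b (M : R) :
  (forall k, 0 <= b k) -> (forall K, \sum_(k < K) b k <= M) ->
  (forall k, s k.+1 <= s k + b k) ->
  (forall e, 0 < e -> forall N, exists2 k, (N <= k)%N & s k < e) ->
  forall e, 0 < e -> exists N, forall k, (N <= k)%N -> s k < e.
Proof.
move=> b0 bM sb s0 e e0.
pose A := [set \sum_(k < K) b k | K in [set: nat]].
have supA : has_sup A.
  by split; [exists 0, 0%N; rewrite ?big_ord0|exists M => _ [K _ <-]].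
have e20 : 0 < e / 2 by lra.
have [_ [N _ <-] hN] := sup_adherent e20 supA.
have tail K : \sum_(k < K) b (N + k)%N <= e / 2.
  have : \sum_(k < N + K) b k <= sup A.
    by apply: sup_upper_bound => //; exists (N + K)%N.
  by rewrite big_split_ord /=; lra.
have [K NK sK] := s0 _ e20 N; exists K => k Kk.
have : s k <= s K + \sum_(i < k - K) b (K + i)%N.
  rewrite -{1}(subnKC Kk); elim: (k - K)%N => [|d IHd].
    by rewrite big_ord0 addn0 addr0.
  by rewrite addnS big_ord_recr/=; have := sb (K + d)%N; lra.
have : \sum_(i < k - K) b (K + i)%N <= e / 2.
  apply: le_trans (tail (k - N)%N).
  have -> : (k - N = (K - N) + (k - K))%N by lia.
  rewrite big_split_ord/= -[leLHS]add0r lerD ?sumr_ge0//.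
  by apply: ler_sum => i _; rewrite addnA subnKC.
lra.
Qed.

End real_sequences.

Section proximal_step.
Context {R : realType} {p : nat}.

Lemma proximal_step (g l0 lp : 'rV[R]_p) (c : R) : 0 < c ->
  argmax orthant (fun l => dotp g l - (2 * c)^-1 * enorm (l - l0) ^+ 2) lp ->
  forall l, orthant l -> dotp (lp - l) (lp - l) <=
    dotp (l0 - l) (l0 - l) + 2 * c * dotp g (lp - l)
      - dotp (lp - l0) (lp - l0).
Proof.
move=> c0 [lp0 lpmax] l l_ge0.
have [u uE] : exists u, u = l - lp by exists (l - lp).
have [r rE] : exists r, r = lp - l0 by exists (lp - l0).
have variation t : 0 < t -> t <= 1 ->
    2 * c * dotp g u - 2 * dotp u r <= t * dotp u u.
  move=> t0 t1; have /lpmax : orthant (lp + t *: u).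
    move=> j; rewrite uE !mxE; have := lp0 j; have := l_ge0 j.
    by move=> h1 h2; have := mulr_ge0 (ltW t0) h1; nra.
  have -> : lp + t *: u - l0 = r + t *: u by rewrite rE addrAC.
  rewrite !sqr_enorm -rE !dotpE (dotpC r u) => h.
  have : 2 * c * (t * dotp g u) <= 2 * (t * dotp u r) + t * (t * dotp u u).
    have cV y : 2 * c * ((2 * c)^-1 * y) = y.
      by rewrite mulrA mulfV ?mul1r// gt_eqF// mulr_gt0.
    move: ((2 * c)^-1) cV h => V cV h.
    have c20 : 0 <= 2 * c by lra.
    have := ler_wpM2l c20 h.
    have := cV (dotp r r); have := cV (t * dotp u r).
    have := cV (t * (t * dotp u u)); lra.
  by move=> h2; rewrite -(ler_pM2l t0); lra.
have first_order : 2 * c * dotp g u <= 2 * dotp u r.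
  rewrite -subr_le0 leNgt; apply/negP => A0.
  have u1 : 0 < dotp u u + 1 by have := dotp_ge0 u; lra.
  have [t1|t1] := leP 1 ((2 * c * dotp g u - 2 * dotp u r) / (dotp u u + 1)).
    have := variation 1 ltr01 (lexx 1).
    by rewrite ler_pdivlMr// in t1; lra.
  have t0 : 0 < (2 * c * dotp g u - 2 * dotp u r) / (dotp u u + 1).
    by rewrite divr_gt0.
  have := variation _ t0 (ltW t1).
  have := divfK (lt0r_neq0 u1) (2 * c * dotp g u - 2 * dotp u r).
  by move: (_ / _) t0 => t t0; lra.
have -> : lp - l = - u by rewrite uE opprB.
have -> : l0 - l = - (u + r).
  by rewrite uE rE addrA subrK opprB.
by rewrite -rE !dotpE (dotpC r u); lra.
Qed.

End proximal_step.

(** * Convergence of the algorithm *)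

Lemma orthant_comb {R : realType} {p m : nat} (w : 'I_m -> R)
    (z : 'I_m -> 'rV[R]_p) :
  (forall j, 0 <= w j) -> (forall j, orthant (z j)) ->
  orthant (\sum_j w j *: z j).
Proof.
move=> w0 z0 k; rewrite summxE; apply: sumr_ge0 => j _.
by rewrite mxE mulr_ge0//; exact: z0.
Qed.

Section coefficients.
Context {R : realType}.
Variable c : nat -> R.
Hypothesis coef : coefficients c.

Lemma coefficients_diverge A : exists K, A < \sum_(k < K) c k.
Proof.
have [_ _ /cvgryPgt/(_ A)[K _ hK] _] := coef; exists K.
by have := hK K (leqnn K); rewrite /series/= big_mkord.
Qed.

Lemma coefficients_square_summable :
  exists C, forall K, \sum_(k < K) c k ^+ 2 <= C.
Proof.
have [_ _ _ cc] := coef; exists (limn (series (fun k => c k ^+ 2))) => K.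
have -> : \sum_(k < K) c k ^+ 2 = series (fun k => c k ^+ 2) K.
  by rewrite /series/= big_mkord.
apply: nondecreasing_cvgn_le => //.
by apply: nondecreasing_series => k _ _; exact: sqr_ge0.
Qed.

End coefficients.

Section algorithm.
Context {R : realType} {m p : nat} {n : 'I_m -> nat}.
Variables (X : forall i, set 'rV[R]_(n i)).
Variables (f : forall i, 'rV[R]_(n i) -> R).
Variables (g : forall i, 'rV[R]_(n i) -> 'rV[R]_p).
Variables (c : nat -> R) (a : nat -> 'I_m -> 'I_m -> R).
Variables (x xhat : nat -> forall i, 'rV[R]_(n i)).
Variable lam : nat -> 'I_m -> 'rV[R]_p.
Hypotheses (convXfg : convexity X f g) (compX : compactness X).
Hypotheses (slaterXg : slater X g) (coef : coefficients c).
Hypotheses (wa : weights a) (ca : connectivity a).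
Hypothesis gen : generated X f g c a x xhat lam.

Let X0 := slater_nonempty X g slaterXg.
Let dsa := weights_doubly_stochastic a wa.
Let c_gt0 k : 0 < c k. Proof. by have [] := coef. Qed.
Local Notation D := (dual_function X f g).

Lemma lam_orthant k i : orthant (lam k i).
Proof.
have [gen0 genS] := gen.
by case: k => [|k]; [have [] := gen0 i|have [_ []] := genS k i].
Qed.

Lemma mixed_orthant k i : orthant (mixed a lam k i).
Proof.
by apply: orthant_comb => j; [have [/(_ i j)] := dsa k|exact: lam_orthant].
Qed.

Lemma avg_orthant k : orthant (avg (lam k)).
Proof.
rewrite /avg scaler_sumr; apply: orthant_comb => j; first by rewrite invr_ge0.
exact: lam_orthant.
Qed.

Variable G : R.
Hypotheses (G0 : 0 <= G) (gG : forall i y, X i y -> `|g i y| <= G).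

Lemma iterate_in k i : X i (x k.+1 i).
Proof. by have [_ /(_ k i)[[]]] := gen. Qed.

Lemma dotp_g_le k i (u : 'rV[R]_p) :
  dotp (g i (x k.+1 i)) u <= p%:R * G * `|u|.
Proof.
apply: le_trans (ler_norm _) _; apply: le_trans (normr_dotp_le _ _) _.
by rewrite ler_wpM2r// ler_wpM2l// gG//; exact: iterate_in.
Qed.

Lemma increment_le k i : `|lam k.+1 i - mixed a lam k i| <= p%:R * G * c k.
Proof.
have [_ /(_ k i)[_ prox _]] := gen.
have := proximal_step _ _ _ _ (c_gt0 k) prox _ (mixed_orthant k i).
set e := lam k.+1 i - _; rewrite subrr dotp0l add0r => h.
have h1 := sqr_normr_le_dotp e; have h2 := dotp_g_le k i e.
have := normr_ge0 e; rewrite le0r => /orP[/eqP->|en].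
  by rewrite !mulr_ge0// ltW.
rewrite -(ler_pM2r en); rewrite expr2 in h1.
by have := ler_wpM2l (ltW (c_gt0 k)) h2; lra.
Qed.

Lemma descent k i l : orthant l ->
  dotp (lam k.+1 i - l) (lam k.+1 i - l) <=
  dotp (mixed a lam k i - l) (mixed a lam k i - l)
  + 2 * c k * (phi X f g i (mixed a lam k i) - phi X f g i l)
  + 2 * (p%:R * G) ^+ 2 * c k ^+ 2.
Proof.
move=> l0; have [_ /(_ k i)[xmin prox _]] := gen.
have := proximal_step _ _ _ _ (c_gt0 k) prox _ l0.
set ell := mixed a lam k i; set y := lam k.+1 i.
have -> : y - l = (ell - l) + (y - ell) by rewrite [RHS]addrC addrA subrK.
have e0 := dotp_ge0 (y - ell).
have h1 : dotp (g i (x k.+1 i)) (y - ell) <= (p%:R * G) ^+ 2 * c k.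
  apply: le_trans (dotp_g_le k i _) _; rewrite expr2 -[leRHS]mulrA ler_wpM2l//.
    by rewrite mulr_ge0.
  exact: increment_le.
have h2 : dotp (g i (x k.+1 i)) (ell - l) <= phi X f g i ell - phi X f g i l.
  have := phi_supergradient X f g convXfg compX X0 i ell l _ xmin.
  by rewrite -(opprB ell l) dotpNr; lra.
have c20 : 0 <= 2 * c k by have := c_gt0 k; lra.
rewrite (dotpDr (ell - l) _ (g i _)).
have := ler_wpM2l c20 h1; have := ler_wpM2l c20 h2; lra.
Qed.

Definition sqdist l k := \sum_i dotp (lam k i - l) (lam k i - l).

Lemma mixed_sqdist_le l k :
  \sum_i dotp (mixed a lam k i - l) (mixed a lam k i - l) <= sqdist l k.
Proof.
have [a0 a1 a2] := dsa k.
apply: (@le_trans _ _ (\sum_i \sum_j a k i j *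
    dotp (lam k j - l) (lam k j - l))).
  apply: ler_sum => i _.
  have -> : mixed a lam k i - l = \sum_j a k i j *: (lam k j - l).
    under eq_bigr do rewrite scalerBr.
    by rewrite sumrB -scaler_suml a1 scale1r.
  exact: dotp_convex_comb.
rewrite exchange_big; apply: ler_sum => j _.
by rewrite -mulr_suml a2 mul1r.
Qed.

Lemma avg_mixed k : avg (mixed a lam k) = avg (lam k).
Proof. by have [_ _ a2] := dsa k; rewrite /avg (sum_mix (a k) (lam k) a2). Qed.

Lemma disagreement_mixed k :
  disagreement (mixed a lam k) <= disagreement (lam k).
Proof.
have [a0 _ _] := dsa k.
have := disagreement_mix (a k) (lam k) 0 (dsa k) a0.
by rewrite mulr0 subr0 mul1r.
Qed.

Definition error k : R := 2 * (p%:R * G) * (c k * disagreement (lam k))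
  + \sum_(i < m) 2 * (p%:R * G) ^+ 2 * c k ^+ 2.

Lemma error_ge0 k : 0 <= error k.
Proof.
have pG : 0 <= p%:R * G by rewrite mulr_ge0.
have cQ := mulr_ge0 (ltW (c_gt0 k)) (disagreement_ge0 (lam k)).
apply: addr_ge0; first by apply: mulr_ge0 => //; exact: mulr_ge0.
by apply: sumr_ge0 => i _; rewrite mulr_ge0 ?sqr_ge0// mulr_ge0 ?sqr_ge0.
Qed.

Lemma sqdist_step l k : orthant l ->
  sqdist l k.+1 <= sqdist l k + 2 * c k * (D (avg (lam k)) - D l) + error k.
Proof.
move=> l0; have pG : 0 <= p%:R * G by rewrite mulr_ge0.
have c20 : 0 <= 2 * c k by have := c_gt0 k; lra.
apply: le_trans (ler_sum _ (fun i _ => descent k i l l0)) _.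
rewrite 2!big_split/= -mulr_sumr sumrB /error addrA lerD2r.
have hphi : \sum_i phi X f g i (mixed a lam k i) <=
    D (avg (lam k)) + p%:R * G * disagreement (lam k).
  apply: (@le_trans _ _ (D (avg (lam k)) +
      p%:R * G * disagreement (mixed a lam k))); last first.
    by rewrite lerD2l ler_wpM2l// disagreement_mixed.
  rewrite /disagreement avg_mixed /sum_norm mulr_sumr /dual_function.
  rewrite -big_split/=.
  apply: ler_sum => i _.
  by apply: phi_lipschitz => //; exact: gG.
have := ler_wpM2l c20 hphi; have := mixed_sqdist_le l k.
by rewrite -/(D l); move: (D _) (D l) => d1 d2; lra.
Qed.

Lemma disagreement_summable :
  exists M, forall K, \sum_(k < K) c k * disagreement (lam k) <= M.
Proof.
have [_ cmono _ _] := coef; have [C hC] := coefficients_square_summable c coef.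
have [B [al [al0 alB]]] := transition_positive a wa ca.
have [m0|m_gt0] := posnP m.
  exists 0 => K; rewrite big1// => k _.
  suff -> : disagreement (lam k) = 0 by rewrite mulr0.
  by apply: big1 => -[i im]; exfalso; rewrite m0 in im.
have mal : 0 < m%:R * al by rewrite mulr_gt0// ltr0n.
pose rho := Num.max 0 (1 - m%:R * al).
have pG : 0 <= p%:R * G by rewrite mulr_ge0.
apply: (@contraction_weighted_summable _ c (fun k => disagreement (lam k)) B
  rho (2 * (m%:R * (p%:R * G))) C) => //.
- by move=> k; exact: ltW.
- by move=> k; exact: disagreement_ge0.
- by rewrite le_max lexx.
- by rewrite gt_max ltr01/= ltrBlDr ltrDl.
- by rewrite !mulr_ge0.
move=> k; rewrite addnC.
have zE k' i : lam k'.+1 i =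
    mix (a k') (lam k') i + (lam k'.+1 i - mixed a lam k' i).
  by rewrite addrC subrK.
have [r rle zs] := transition_unroll a dsa lam _ k zE B.
have -> : lam (k + B)%N =
    (fun i => mix (transition a k B) (lam k) i + r i).
  by apply/funext => i; exact: zs.
apply: le_trans (disagreement_perturb _ _) _; apply: lerD.
  have tds := transition_doubly_stochastic a dsa k B.
  apply: le_trans (disagreement_mix _ (lam k) _ tds (alB k)) _.
  by rewrite ler_wpM2r ?disagreement_ge0// le_max lexx orbT.
rewrite -mulrA ler_wpM2l//; apply: le_trans rle _.
rewrite mulr_sumr; apply: ler_sum => t _.
apply: le_trans (ler_sum _ (fun i _ => increment_le (k + t) i)) _.
by rewrite sumr_const card_ord -[leLHS]mulr_natl !mulrA.
Qed.

Lemma error_summable : exists M, forall K, \sum_(k < K) error k <= M.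
Proof.
have [M hM] := disagreement_summable.
have [C hC] := coefficients_square_summable c coef.
have pG : 0 <= p%:R * G by rewrite mulr_ge0.
exists (2 * (p%:R * G) * M + \sum_(i < m) 2 * (p%:R * G) ^+ 2 * C) => K.
rewrite big_split/= -mulr_sumr exchange_big/=; apply: lerD.
  by apply: ler_wpM2l (hM K); exact: mulr_ge0.
apply: ler_sum => i _; rewrite -mulr_sumr; apply: ler_wpM2l (hC K).
by apply: mulr_ge0 => //; exact: sqr_ge0.
Qed.

End algorithm.

Section convergence.
Context {R : realType} {m p : nat} {n : 'I_m -> nat}.
Variables (X : forall i, set 'rV[R]_(n i)).
Variables (f : forall i, 'rV[R]_(n i) -> R).
Variables (g : forall i, 'rV[R]_(n i) -> 'rV[R]_p).
Variables (c : nat -> R) (a : nat -> 'I_m -> 'I_m -> R).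
Variables (x xhat : nat -> forall i, 'rV[R]_(n i)).
Variable lam : nat -> 'I_m -> 'rV[R]_p.
Hypotheses (convXfg : convexity X f g) (compX : compactness X).
Hypotheses (slaterXg : slater X g) (coef : coefficients c).
Hypotheses (wa : weights a) (ca : connectivity a).
Hypothesis gen : generated X f g c a x xhat lam.
Local Notation D := (dual_function X f g).

Variable i0 : 'I_m.

Lemma agent_near_avg k i :
  `|lam k i - avg (lam k)| <= disagreement (lam k).
Proof. by rewrite /disagreement /sum_norm (bigD1 i)//= lerDl sumr_ge0. Qed.

Lemma optimal_cluster : exists2 l : 'rV[R]_p, dual_optima X f g l &
  forall e, 0 < e -> forall N, exists2 k, (N <= k)%N &
    forall i, `|lam k i - l| < e.
Proof.
have [G G0 gG] :=
  constraint_bounded X f g convXfg compX (slater_nonempty X g slaterXg).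
have [C hC] :=
  error_summable X f g c a x xhat lam coef wa ca gen G G0 gG.
have [Q hQ] :=
  disagreement_summable X f g c a x xhat lam coef wa ca gen G G0 gG.
have [K K0 DK] := dual_lipschitz X f g convXfg compX slaterXg.
have [ls [ls0 lsmax]] := dual_optima_nonempty X f g convXfg compX slaterXg.
have {}lsmax l : orthant l -> D l <= D ls by exact: lsmax.
have c0 k : 0 < c k by have [] := coef.
have v0 := avg_orthant X f g c a x xhat lam gen.
pose gap k := D ls - D (avg (lam k)).
have gap0 k : 0 <= gap k by rewrite subr_ge0; exact/lsmax/v0.
have step k : sqdist lam ls k.+1 + 2 * (c k * gap k) <=
    sqdist lam ls k + error c lam G k.
  have := sqdist_step X f g c a x xhat lam convXfg compX slaterXg coef wa gen
    G G0 gG ls k ls0.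
  by rewrite /gap; lra.
have sum_step N : sqdist lam ls N + 2 * \sum_(k < N) c k * gap k <=
    sqdist lam ls 0 + \sum_(k < N) error c lam G k.
  elim: N => [|N IHN]; first by rewrite !big_ord0 mulr0 !addr0.
  by rewrite !big_ord_recr/=; have := step N; lra.
have sq0 N : 0 <= sqdist lam ls N by apply: sumr_ge0 => i _; exact: dotp_ge0.
have cgap0 N : 0 <= \sum_(k < N) c k * gap k.
  by apply: sumr_ge0 => k _; rewrite mulr_ge0// ltW.
pose w k := gap k + disagreement (lam k).
have w0 k : 0 <= w k by rewrite addr_ge0 ?disagreement_ge0.
have wsum N : \sum_(k < N) c k * w k <= (sqdist lam ls 0 + C) / 2 + Q.
  under eq_bigr do rewrite mulrDr.
  rewrite big_split/=; apply: lerD (hQ N).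
  by have := sum_step N; have := hC N; have := sq0 N; lra.
have wlim := weighted_summable_liminf0 c w _ c0
  (coefficients_diverge c coef) w0 wsum.
have /choice[s sP] (N : nat) : exists k, (N <= k)%N /\ w k < N.+1%:R^-1.
  have N0 : 0 < N.+1%:R^-1 :> R by rewrite invr_gt0 ltr0n.
  by have [k Nk wk] := wlim _ N0 N; exists k.
have [|l _ cl] := bounded_cluster (fun N => lam (s N) i0)
    (`|ls| + (1 + (sqdist lam ls 0 + C))).
  move=> k j; apply: le_trans (normr_coord _ j) _.
  rewrite -(subrK ls (lam (s k) i0)) addrC; apply: le_trans (ler_normD _ _) _.
  rewrite lerD2l; set y := lam (s k) i0 - ls.
  have h1 : `|y| ^+ 2 <= sqdist lam ls (s k).
    apply: le_trans (sqr_normr_le_dotp y) _.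
    rewrite /sqdist (bigD1 i0)//= lerDl.
    by apply: sumr_ge0 => i _; exact: dotp_ge0.
  have := sum_step (s k); have := hC (s k); have := cgap0 (s k).
  by have := normr_ge0 y; move: `|y| h1 => b; nra.
have {}cl e : 0 < e -> forall N, exists k,
    [/\ (N <= k)%N, w k < e & `|lam k i0 - l| < e].
  move=> e0 N; have [k Nk kl] := cl e e0 (maxn N (Num.Def.truncn e^-1)).
  move: Nk; rewrite geq_max => /andP[Nk ek]; have [sk wk] := sP k.
  exists (s k); split=> //; first exact: leq_trans sk.
  apply: lt_le_trans wk _; rewrite -[leRHS]invrK lef_pV2 ?posrE ?invr_gt0//.
  by apply/ltW/(lt_le_trans (truncnS_gt _)); rewrite ler_nat ltnS.
have near e : 0 < e -> forall N, exists k, [/\ (N <= k)%N, gap k < e,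
    `|avg (lam k) - l| < e & forall i, `|lam k i - l| < e].
  move=> e0 N; have e30 : 0 < e / 3 by lra.
  have [k [Nk wk kl]] := cl _ e30 N.
  have dk : disagreement (lam k) < e / 3.
    by have := gap0 k; rewrite /w in wk; lra.
  have vl : `|avg (lam k) - l| < 2 * (e / 3).
    rewrite -(subrK (lam k i0) (avg (lam k))) -addrA.
    apply: le_lt_trans (ler_normD _ _) _.
    by have := agent_near_avg k i0; rewrite distrC; lra.
  exists k; split=> // [||i].
    by have := disagreement_ge0 (lam k); rewrite /w in wk; lra.
    by lra.
  rewrite -(subrK (avg (lam k)) (lam k i)) -addrA.
  apply: le_lt_trans (ler_normD _ _) _.
  by have := agent_near_avg k i; lra.
exists l; last by move=> e e0 N; have [k [Nk _ _ ?]] := near e e0 N; exists k.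
have l0 : orthant l.
  apply: orthant_limit => e e0; have [k [_ _ _ ?]] := near e e0 0%N.
  exists (lam k i0) => //; exact: (lam_orthant X f g c a x xhat lam gen).
have Dl : D ls <= D l.
  apply/ler_addgt0Pr => e e0.
  have e'0 : 0 < e / (K + 1) by rewrite divr_gt0//; lra.
  have [k [_ gk vk _]] := near _ e'0 0%N.
  have h := DK l (avg (lam k)).
  have eE : e = K * (e / (K + 1)) + e / (K + 1).
    by field; rewrite gt_eqF//; lra.
  have := ler_wpM2l K0 (ltW vk).
  by move: eE gk; rewrite /gap; move: (e / _) => q; lra.
by split=> // mu /lsmax /le_trans; apply.
Qed.

End convergence.

Theorem theorem1 (R : realType) (m p : nat) (n : 'I_m -> nat)
  (X : forall i, set 'rV[R]_(n i))
  (f : forall i, 'rV[R]_(n i) -> R)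
  (g : forall i, 'rV[R]_(n i) -> 'rV[R]_p)
  (c : nat -> R) (a : nat -> 'I_m -> 'I_m -> R)
  (x xhat : nat -> forall i, 'rV[R]_(n i))
  (lam : nat -> 'I_m -> 'rV[R]_p) :
  convexity X f g -> compactness X -> slater X g ->
  coefficients c -> weights a -> connectivity a ->
  generated X f g c a x xhat lam ->
  exists2 lamstar : 'rV[R]_p, dual_optima X f g lamstar &
    forall i, (fun k => enorm (lam k i - lamstar)) @ \oo --> (0 : R).
Proof.
move=> convXfg compX slaterXg coef wa ca gen.
have [m0|m_gt0] := posnP m.
  have [l lmax] := dual_optima_nonempty X f g convXfg compX slaterXg.
  by exists l => // -[i im]; exfalso; rewrite m0 in im.
have [l lopt cl] := optimal_cluster X f g c a x xhat lam convXfg compX slaterXg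
  coef wa ca gen (Ordinal m_gt0).
exists l => // i; have [l0 lmax] := lopt.
have [G G0 gG] :=
  constraint_bounded X f g convXfg compX (slater_nonempty X g slaterXg).
have [C hC] :=
  error_summable X f g c a x xhat lam coef wa ca gen G G0 gG.
have err0 := error_ge0 c lam coef G G0.
have step k : sqdist lam l k.+1 <= sqdist lam l k + error c lam G k.
  apply: le_trans (sqdist_step X f g c a x xhat lam convXfg compX slaterXg coef
    wa gen G G0 gG l k l0) _.
  rewrite lerD2r gerDl mulr_ge0_le0//.
    by rewrite mulr_ge0// ltW//; case: coef.
  rewrite subr_le0; apply: lmax.
  exact: (avg_orthant X f g c a x xhat lam gen).
have liminf e : 0 < e -> forall N, exists2 k, (N <= k)%N & sqdist lam l k < e.
  move=> e0 N; pose d := Num.min 1 (e / (m%:R * p%:R + 1)).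
  have mp0 : 0 < m%:R * p%:R + 1 :> R by rewrite ltr_wpDl// mulr_ge0.
  have d0 : 0 < d by rewrite lt_min ltr01 divr_gt0.
  have [k Nk kl] := cl d d0 N; exists k => //.
  apply: (@le_lt_trans _ _ (\sum_(i < m) p%:R * d)).
    apply: ler_sum => j _; apply: le_trans (dotp_le_sqr_normr _) _.
    rewrite ler_wpM2l//; apply: (@le_trans _ _ (d ^+ 2)).
      by rewrite ler_sqr ?nnegrE ?(ltW d0)// ltW//; exact: kl.
    by rewrite expr2 ler_piMl ?(ltW d0)// /d ge_min lexx.
  rewrite sumr_const card_ord -[ltLHS]mulr_natl mulrA.
  have : d <= e / (m%:R * p%:R + 1) by rewrite /d ge_min lexx orbT.
  by rewrite ler_pdivlMr//; move: (_ * _ : R) mp0 => q; lra.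
have sqlim := quasi_monotone_cvg0 _ _ _ err0 hC step liminf.
apply/cvgr0Pnorm_lt => e e0.
have [N hN] := sqlim _ (exprn_gt0 2 e0); exists N => // k /hN sk.
rewrite /= ger0_norm ?sqrtr_ge0// -[ltRHS]gtr0_norm// -sqrtr_sqr.
rewrite ltr_sqrt ?exprn_gt0//; apply: le_lt_trans sk.
rewrite /sqdist (bigD1 i)//= lerDl.
by apply: sumr_ge0 => j _; exact: dotp_ge0.
Qed.
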